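(* Let $n\ge1$ and let $X_1,\dots,X_n$ be $n$ nonnegative heavy-tailed random variables with distributions $F_1,\dots,F_n$, respectively, where $\overline{F_k}(x)=1-F_k(x)>0$ for all $x$ and all $k$. Assume that for all $1\le i\ne j\le n$, $$\lim_{\min(x_i,x_j)\to\infty}P(|X_i|>x_i\mid X_j>x_j)=0.$$ Let $S_n=\sum_{k=1}^n X_k$ and $S_{(n)}=\max_{1\le k\le n}S_k$, where $S_k=\sum_{j=1}^k X_j$. If $F_k\in\mathcal{D}$ for $k=1,\dots,n$, then $$\liminf_{x\to\infty}\frac{P(S_n>x)}{\sum_{k=1}^n\overline{F_k}(x)}=\liminf_{x\to\infty}\frac{P(S_{(n)}>x)}{\sum_{k=1}^n\overline{F_k}(x)}=1.$$ Moreover, if in addition $F_k\in\mathcal{L}$ for $k=1,\dots,n$, then $$\lim_{x\to\infty}\frac{P(S_n>x)}{\sum_{k=1}^n\overline{F_k}(x)}=\lim_{x\to\infty}\frac{P(S_{(n)}>x)}{\sum_{k=1}^n\overline{F_k}(x)}=1.$$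
   Context: A random variable $X$ (or its distribution) is heavy-tailed if $E e^{\alpha X}=\infty$ for all $\alpha>0$. For a distribution $F$, $\overline{F}=1-F$. $F$ belongs to $\mathcal{D}$ (dominatedly varying tails) if $\limsup_{x\to\infty}\overline{F}(xy)/\overline{F}(x)<\infty$ for some (equivalently, for all) $0<y<1$. $F$ belongs to $\mathcal{L}$ (long tails) if $\lim_{x\to\infty}\overline{F}(x+y)/\overline{F}(x)=1$ for all $y\in\mathbb{R}$. *)

(* Defs.v *)
From HB Require Import structures.
From mathcomp Require Import all_boot all_order all_algebra.
From mathcomp Require Import all_classical all_reals all_analysis.
Set Implicit Arguments.
Unset Strict Implicit.
Unset Printing Implicit Defensive.
Import Order.TTheory GRing.Theory Num.Theory.
Import numFieldNormedType.Exports.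
Local Open Scope classical_set_scope.
Local Open Scope ring_scope.

Definition distr_fun d (T : measurableType d) (R : realType)
    (P : probability T R) (X : {RV P >-> R}) : R -> R :=
  fun x => fine (cdf X x).

Definition tail (R : realType) (F : R -> R) : R -> R := fun x => 1 - F x.

(* ['M_P X alpha] is E(exp(alpha X)). *)
Definition heavy_tailed d (T : measurableType d) (R : realType)
    (P : probability T R) (X : {RV P >-> R}) : Prop :=
  forall alpha : R, 0 < alpha -> 'M_P X alpha = +oo%E.

Definition dominated_tail (R : realType) (F : R -> R) : Prop :=
  exists2 y : R, 0 < y < 1 &
    (limf_esup (fun x : R => (tail F (x * y) / tail F x)%:E) +oo%R < +oo)%E.

Definition long_tail (R : realType) (F : R -> R) : Prop :=
  forall y : R, tail F (x + y) / tail F x @[x --> +oo%R] --> (1 : R).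

(* Meaningful when [P B] is nonzero; it is [0] otherwise. *)
Definition cond_prob d (T : measurableType d) (R : realType)
    (P : probability T R) (A B : set T) : R :=
  fine (P (A `&` B)) / fine (P B).

(* The filter [(+oo, +oo)] on pairs is generated by the sets
   [[set p | M < Num.min p.1 p.2]]: it is the limit min(x_i, x_j) -> oo. *)
Definition pairwise_tail_independent d (T : measurableType d) (R : realType)
    (P : probability T R) (n : nat) (X : 'I_n -> {RV P >-> R}) : Prop :=
  forall i j : 'I_n, i != j ->
    (fun p : R * R => cond_prob P [set t | `|X i t| > p.1] [set t | X j t > p.2])
      @ (+oo%R : set_system R, +oo%R : set_system R) --> (0 : R).

(* Indices are shifted: [partial_sum X k] is the sum of the first k + 1
   variables. *)
Definition partial_sum d (T : measurableType d) (R : realType)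
    (P : probability T R) (n : nat) (X : 'I_n -> {RV P >-> R}) (k : nat)
    (t : T) : R :=
  \sum_(j < n | (j <= k)%N) X j t.

Definition total_sum d (T : measurableType d) (R : realType)
    (P : probability T R) (n : nat) (X : 'I_n -> {RV P >-> R}) (t : T) : R :=
  \sum_(j < n) X j t.

(* For n >= 1 the default value [total_sum X t] of the big operator is the
   last of the partial sums, so this is exactly their maximum. *)
Definition max_partial_sum d (T : measurableType d) (R : realType)
    (P : probability T R) (n : nat) (X : 'I_n -> {RV P >-> R}) (t : T) : R :=
  \big[Num.max/total_sum X t]_(k < n) partial_sum X k t.

Definition tail_ratio d (T : measurableType d) (R : realType)
    (P : probability T R) (n : nat) (X : 'I_n -> {RV P >-> R}) (S : T -> R)
    (x : R) : R :=
  fine (P [set t | S t > x]) / \sum_(k < n) tail (distr_fun (X k)) x.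

(* Main.v *)
(** Since the variables are nonnegative, the maximal partial sum is the total
sum S. Write F_k for the tail of X_k and B for the sum of the F_k. From
{S > x} containing the union of the {X_k > x}, Bonferroni and pairwise tail
independence give P(S > x) >= (1 - e) B(x) for large x. Conversely, S > x
forces either some X_k > x - l, or X_k > x / (n + 1) and X_j > l / (n + 1) for
some j <> k; choosing l large, tail independence and dominated variation bound
the second event by e B(x), so P(S > x) <= B(x - l) + e B(x). Long tails give
B(x - l) ~ B(x), hence the limit. Without them, B(x - l) <= (1 + e) B(x) still
holds for arbitrarily large x, since otherwise B would decay exponentially,
which dominated variation forbids; hence the lower limit. *)

Require Import Defs.
From HB Require Import structures.
From mathcomp Require Import all_boot all_order all_algebra.
From mathcomp Require Import all_classical all_reals all_analysis.
From mathcomp Require Import lra.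
Set Implicit Arguments.
Unset Strict Implicit.
Import Order.TTheory GRing.Theory Num.Theory.
Import numFieldNormedType.Exports.
Local Open Scope classical_set_scope.
Local Open Scope ring_scope.

(** [limf_einf] is minus the upper limit of [- f], an infimum of suprema over neighbourhoods of
    infinity. The first hypothesis supplies a neighbourhood with a small supremum; the second puts
    into every neighbourhood a point where [- f] is at least [- l - e]. *)
Lemma limf_einf_pinfty_eq (R : realType) (f : R -> R) (l : R) :
  (forall e, 0 < e -> \forall x \near +oo, l - e <= f x) ->
  (forall e M, 0 < e -> exists2 x, M < x & f x <= l + e) ->
  limf_einf (fun x => (f x)%:E) +oo = l%:E.
Proof.
move=> lbf ubf; rewrite /limf_einf /limf_esup /=.
apply/eqP; rewrite eqe_oppLR; apply/eqP/le_anti/andP; split.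
- apply/lee_addgt0Pr => e e0; rewrite -EFinN -EFinD.
  apply: (@le_trans _ _ (ereal_sup
    [set (\- (fun x => (f x)%:E))%E x | x in [set x | l - e <= f x]])).
    by apply: ereal_inf_lbound; exists [set x | l - e <= f x] => //; exact: lbf.
  by apply: ge_ereal_sup => _ [x /= lfx <-]; rewrite lee_fin; lra.
- apply: le_ereal_inf_tmp => _ [V [M [_ MV]] <-].
  apply/lee_addgt0Pr => e e0.
  have [x Mx fx] := ubf e M e0.
  rewrite -leeBlDr//; apply: (@le_trans _ _ (- (f x)%:E)%E).
    by rewrite lee_fin; lra.
  by apply: ereal_sup_ubound; exists x => //; exact: MV.
Qed.

Lemma in_bigsetU (I : finType) (U : Type) (Q : pred I) (A : I -> set U) (u : U) :
  (\big[setU/set0]_(i | Q i) A i) u <-> exists2 i, Q i & A i u.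
Proof.
rewrite -bigcup_seq_cond; split=> [[i /= /andP[_ Qi] Au]|[i Qi Au]].
  by exists i.
by exists i => //=; rewrite mem_index_enum.
Qed.

(** * Finite unions: the union bound and Bonferroni's inequality *)

Section probability_of_unions.
Context {R : realType} {d : measure_display} {T : measurableType d}.
Variable P : probability T R.

Lemma le_fine_prob (A B : set T) : measurable A -> measurable B ->
  A `<=` B -> fine (P A) <= fine (P B).
Proof.
by move=> mA mB AB; rewrite fine_le ?fin_num_measure// le_measure ?inE.
Qed.

Lemma fine_probU (A B : set T) : measurable A -> measurable B ->
  fine (P (A `|` B)) = fine (P A) + fine (P B) - fine (P (A `&` B)).
Proof.
move=> mA mB; rewrite measureUfinl ?ltey_eq ?fin_num_measure//.
have mAB := measurableI _ _ mA mB.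
by rewrite fineB ?fin_numD ?fin_num_measure// fineD ?fin_num_measure.
Qed.

Lemma fine_probU_le (A B : set T) : measurable A -> measurable B ->
  fine (P (A `|` B)) <= fine (P A) + fine (P B).
Proof. by move=> mA mB; rewrite fine_probU// gerBl fine_ge0. Qed.

Lemma fine_prob_bigU (I : Type) (s : seq I) (Q : pred I) (A : I -> set T) :
  (forall i, measurable (A i)) ->
  fine (P (\big[setU/set0]_(i <- s | Q i) A i)) <=
  \sum_(i <- s | Q i) fine (P (A i)).
Proof.
move=> mA; elim: s => [|i s IH]; first by rewrite !big_nil measure0.
rewrite !big_cons; case: ifP => // Qi.
have mU : measurable (\big[setU/set0]_(j <- s | Q j) A j).
  by apply: bigsetU_measurable.
by rewrite (le_trans (fine_probU_le _ _))// lerD2l.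
Qed.

(** Bonferroni by induction: adding [a] costs the intersection of [A a] with the old union, which
    the union bound controls by the row of [a] in the double sum. Each unordered pair is counted
    twice, which only weakens the bound. *)
Lemma fine_prob_bigU_ge (I : eqType) (s : seq I) (A : I -> set T) : uniq s ->
  (forall i, measurable (A i)) ->
  \sum_(i <- s) fine (P (A i)) -
  \sum_(i <- s) \sum_(j <- s | j != i) fine (P (A i `&` A j)) <=
  fine (P (\big[setU/set0]_(i <- s) A i)).
Proof.
move=> + mA; elim: s => [|a s IH]; first by rewrite !big_nil measure0 subr0.
move=> /= /andP[aNs /IH {}IH].
have mU : measurable (\big[setU/set0]_(j <- s) A j).
  by apply: bigsetU_measurable.
rewrite 4!big_cons eqxx/= fine_probU//.
have inter : fine (P (A a `&` \big[setU/set0]_(j <- s) A j)) <=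
    \sum_(j <- s | j != a) fine (P (A a `&` A j)).
  rewrite big_distrr/=.
  apply: le_trans; first by apply: fine_prob_bigU => i; exact: measurableI.
  rewrite [leLHS]big_seq [leRHS]big_seq_cond.
  rewrite (eq_bigl (fun j => (j \in s) && (j != a)))// => j.
  by case: (eqVneq j a) => [->|_]; rewrite ?(negbTE aNs) ?andbT.
have mono : \sum_(i <- s) \sum_(j <- s | j != i) fine (P (A i `&` A j)) <=
    \sum_(i <- s) \sum_(j <- a :: s | j != i) fine (P (A i `&` A j)).
  apply: ler_sum => i _; rewrite big_cons; case: ifP => // _.
  by rewrite lerDr fine_ge0.
lra.
Qed.

Lemma measurable_gt (f : T -> R) (x : R) : measurable_fun setT f ->
  measurable [set t | f t > x].
Proof.
move=> mf; rewrite (_ : mkset _ = setT `&` f @^-1` `]x, +oo[%classic).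
  exact: mf.
by rewrite setTI; apply/seteqP; split=> t /=; rewrite in_itv/= andbT.
Qed.

Lemma tail_distr_fun (X : {RV P >-> R}) (x : R) :
  tail (distr_fun X) x = fine (P [set t | X t > x]).
Proof.
rewrite (_ : mkset _ = ~` (X @^-1` `]-oo, x]%classic)); last first.
  by apply/seteqP; split=> t /=; rewrite in_itv/= leNgt;
    [move=> ->|move/negP; rewrite negbK].
have mX : measurable (X @^-1` `]-oo, x]%classic).
  by rewrite -[X in measurable X]setTI; exact: measurable_funP.
by rewrite probability_setC// fineB ?fin_num_measure.
Qed.

End probability_of_unions.

(** * Consequences of dominated variation *)

Lemma bernoulli_ge (R : realType) (u : R) (m : nat) : 0 <= u ->
  1 + m%:R * u <= (1 + u) ^+ m.
Proof.
move=> u0; elim: m => [|m IH]; first by rewrite expr0 mul0r addr0.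
rewrite exprS -natr1; apply: (@le_trans _ _ ((1 + u) * (1 + m%:R * u))).
  have : 0 <= m%:R * u * u by rewrite !mulr_ge0.
  lra.
by rewrite ler_wpM2l//; lra.
Qed.

(** Otherwise [F] shrinks by a factor [1 + e] over every step of length [l] beyond [M]. Then [m]
    steps from [t] to [2 t] give [(1 + e) ^+ m * F (2 t) <= F t <= C * F (2 t)], against Bernoulli's
    inequality once [m * e > C]. *)
Lemma dominated_shift (R : realType) (F : R -> R) (C l e M : R) :
  (forall x, 0 < F x) -> (\forall x \near +oo, F (x / 2) <= C * F x) ->
  0 < l -> 0 < e -> exists2 x, M < x & F (x - l) <= (1 + e) * F x.
Proof.
move=> F0 [M1 [_ domF]] l0 e0; apply: contrapT => /forall2NP noshift.
have step x : M < x -> (1 + e) * F x < F (x - l).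
  by move=> Mx; have [//|/negP] := noshift x; rewrite -ltNge.
(* Any [m > K] satisfies at once [m * l > M], [m * l > M1] and [m * e > C]. *)
pose K := `|M| / l + `|M1| / l + `|C| / e + 1.
have K0 : 0 <= K by rewrite !addr_ge0// divr_ge0// ltW.
have := archi_boundP K0; set m := Num.Def.archi_bound K => Km.
pose t := m%:R * l.
have q0 : [/\ 0 <= `|M| / l, 0 <= `|M1| / l & 0 <= `|C| / e].
  by split; apply: divr_ge0 => //; exact: ltW.
have Mt : M < t.
  rewrite (le_lt_trans (ler_norm _))// -ltr_pdivrMr//; case: q0.
  by rewrite /K in Km; lra.
have M1t : M1 < t.
  rewrite (le_lt_trans (ler_norm _))// -ltr_pdivrMr//; case: q0.
  by rewrite /K in Km; lra.
have Cm : C < m%:R * e.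
  rewrite (le_lt_trans (ler_norm _))// -ltr_pdivrMr//; case: q0.
  by rewrite /K in Km; lra.
have t0 : 0 < t by rewrite mulr_gt0// (le_lt_trans K0 Km).
have decay j : (1 + e) ^+ j * F (t + j%:R * l) <= F t.
  elim: j => [|j IH]; first by rewrite expr0 mul1r mul0r addr0.
  apply: le_trans IH; rewrite exprSr -mulrA ler_wpM2l ?exprn_ge0//; first lra.
  have := step (t + j.+1%:R * l).
  rewrite -natr1 mulrDl mul1r addrA addrK => /(_ _)/ltW; apply.
  have : 0 <= j%:R * l by rewrite mulr_ge0// ltW.
  lra.
have /domF : M1 < t + t by lra.
rewrite (_ : (t + t) / 2 = t); last by lra.
move=> domt; have := le_trans (decay m) domt; rewrite ler_pM2r//.
have := @bernoulli_ge _ e m (ltW e0); lra.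
Qed.

(** Passes from one factor [y] to every [a > 0]: iterate the bound for [y] until [y ^+ m.+1 <= a],
    then use monotonicity of the tail. *)
Lemma dominated_tailP (R : realType) (F : R -> R) (a : R) :
  {homo tail F : x y / x <= y >-> y <= x} -> (forall x, 0 < tail F x) ->
  dominated_tail F -> 0 < a ->
  exists2 C, 0 <= C & \forall x \near +oo, tail F (x * a) <= C * tail F x.
Proof.
move=> Fdecr F0 [y /andP[y0 y1]] + a0.
move=> /ereal_inf_lt[_ [V [M [_ MV]] <-]].
set s := ereal_sup _ => soo.
have [C C0 domy] : exists2 C, 0 <= C &
    forall x, M < x -> tail F (x * y) <= C * tail F x.
  exists (Num.max 0 (fine s)) => [|x Mx]; first by rewrite le_max lexx.
  rewrite -ler_pdivrMr// le_max; apply/orP; right.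
  have sx : ((tail F (x * y) / tail F x)%:E <= s)%E.
    by apply: ereal_sup_ubound; exists x => //; exact: MV.
  rewrite -lee_fin fineK// fin_numElt soo andbT.
  by apply: lt_le_trans sx; rewrite ltNyr.
have iter m x : 0 <= x -> M < x * y ^+ m ->
    tail F (x * y ^+ m.+1) <= C ^+ m.+1 * tail F x.
  move=> x0; elim: m => [|m IH]; first by rewrite expr0 mulr1 !expr1; exact: domy.
  move=> Mxm; rewrite exprSr mulrA (le_trans (domy _ Mxm))// [C ^+ _]exprS -mulrA.
  rewrite ler_wpM2l// IH// (lt_le_trans Mxm)// exprSr mulrA ler_piMr//;
    last exact: ltW.
  by rewrite mulr_ge0// exprn_ge0// ltW.
have [m ym] : exists m, y ^+ m.+1 <= a.
  have : y ^+ n @[n --> \oo] --> (0 : R).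
    by apply: cvg_expr; rewrite ger0_norm// ltW.
  move=> /cvgrPdist_le/(_ _ a0)[m _ ym]; exists m.
  have := ym m.+1 (leqnSn m); rewrite /= sub0r normrN ger0_norm//.
  by rewrite exprn_ge0// ltW.
exists (C ^+ m.+1); first exact: exprn_ge0.
(* Beyond this threshold even the last point [x * y ^+ m] of the iteration exceeds [M]; the absolute
   value also forces [0 <= x]. *)
exists (`|M| / y ^+ m); split=> [|x]; first by rewrite num_real.
rewrite ltr_pdivrMr ?exprn_gt0// => Mx.
have x0 : 0 <= x.
  by rewrite -(pmulr_lge0 _ (exprn_gt0 m y0)) (le_trans _ (ltW Mx)).
apply: le_trans (iter m x x0 (le_lt_trans (ler_norm _) Mx)).
by apply: Fdecr; rewrite ler_wpM2l.
Qed.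

(** * Bounds for the tail of the sum, and the limits *)

Section tail_of_sum.
Context {R : realType} {d : measure_display} {T : measurableType d}.
Variables (P : probability T R) (n : nat) (X : 'I_n -> {RV P >-> R}).
Hypothesis X_ge0 : forall (k : 'I_n) (t : T), 0 <= X k t.

Let F k := tail (distr_fun (X k)).
Let B x := \sum_(k < n) F k x.
Let G x := fine (P [set t | total_sum X t > x]).

Let mX k x : measurable [set t | X k t > x].
Proof. exact: measurable_gt. Qed.

Let mS x : measurable [set t | total_sum X t > x].
Proof. by apply: measurable_gt; exact: measurable_sum. Qed.

Lemma tail_decr k : {homo F k : x y / x <= y >-> y <= x}.
Proof.
move=> x y xy; rewrite /F !tail_distr_fun le_fine_prob// => t /=.
exact: le_lt_trans.
Qed.

Lemma max_partial_sumE : max_partial_sum X = total_sum X.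
Proof.
(* The default value of the maximum is the total sum, so it suffices that no partial sum exceeds
   it. *)
apply/funext => t; rewrite /max_partial_sum; apply: bigmax_eq_id => k _.
rewrite /partial_sum /total_sum big_mkcond/=; apply: ler_sum => j _.
by case: ifP.
Qed.

Hypothesis F_gt0 : forall k x, 0 < F k x.
Hypothesis X_indep : pairwise_tail_independent X.

(** Tail independence multiplied by the probability of the conditioning event [X i > a]; one
    threshold serves all of the finitely many pairs. *)
Lemma joint_tail_le (e : R) : 0 < e -> exists M, forall i j a b, j != i ->
  M < a -> M < b ->
  fine (P ([set t | X i t > a] `&` [set t | X j t > b])) <= e * F i a.
Proof.
move=> e0.
suff /choice[M HM] : forall ij : 'I_n * 'I_n, exists M, forall a b,
    ij.2 != ij.1 -> M < a -> M < b ->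
    fine (P ([set t | X ij.1 t > a] `&` [set t | X ij.2 t > b])) <= e * F ij.1 a.
  exists (\sum_ij `|M ij|) => i j a b ji Ma Mb.
  have Mle : M (i, j) <= \sum_ij `|M ij|.
    by rewrite (le_trans (ler_norm _))// (bigD1 (i, j))//= lerDl sumr_ge0.
  by apply: (HM (i, j)) => //=; exact: le_lt_trans Mle _.
move=> [i j] /=; case: (eqVneq j i) => [_|ji]; first by exists 0.
have /cvgrPdist_le/(_ _ e0)[[U V] /= [[M1 [_ U1]] [M2 [_ V1]]] UV] := X_indep ji.
exists (Num.max M1 M2) => a b _; rewrite !gt_max => /andP[_ M2a] /andP[M1b _].
have := UV (b, a) (conj (U1 _ M1b) (V1 _ M2a)).
rewrite /= sub0r normrN /cond_prob -tail_distr_fun -/(F i a).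
move=> /(le_trans (ler_norm _)); rewrite ler_pdivrMr//; apply: le_trans.
rewrite setIC (_ : [set t | `|X j t| > b] = [set t | X j t > b])//.
by apply/seteqP; split=> t /=; rewrite ger0_norm.
Qed.

Lemma tail_sum_lower (e : R) : 0 < e ->
  \forall x \near +oo, (1 - e) * B x <= G x.
Proof.
(* Each row of the Bonferroni correction has at most [n] terms, so it stays below [e * F i x]. *)
move=> e0; have e'0 : 0 < e / n.+1%:R by rewrite divr_gt0.
have [M HM] := joint_tail_le e'0.
exists M; split=> [|x Mx]; first by rewrite num_real.
have sub : \big[setU/set0]_(k < n) [set t | X k t > x] `<=`
    [set t | total_sum X t > x].
  move=> t /in_bigsetU[k _ /= xk].
  by apply: lt_le_trans xk _; rewrite /total_sum (bigD1 k)//= lerDl sumr_ge0.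
apply: (le_trans _ (le_fine_prob _ _ _ sub)) => //; last first.
  by apply: bigsetU_measurable.
apply: (le_trans _ (fine_prob_bigU_ge _ _ _)) => //; last exact: index_enum_uniq.
rewrite mulrBl mul1r lerB//.
  by apply: ler_sum => k _; rewrite /F tail_distr_fun.
rewrite /B mulr_sumr; apply: ler_sum => i _.
apply: (@le_trans _ _ (\sum_(j < n) e / n.+1%:R * F i x)).
  rewrite big_mkcond/=; apply: ler_sum => j _; case: ifP => [ji|_].
    exact: HM.
  by rewrite mulr_ge0// ltW.
rewrite sumr_const card_ord -[leLHS]mulr_natr mulrAC ler_wpM2r//;
  first exact: ltW.
by rewrite mulrAC ler_pdivrMr// ler_wpM2l ?ler_nat// ltW.
Qed.

Hypothesis X_dom : forall k, dominated_tail (distr_fun (X k)).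

Lemma dominated_tails (a : R) : 0 < a -> exists2 C, 0 <= C &
  \forall x \near +oo, forall k, F k (x * a) <= C * F k x.
Proof.
move=> a0.
have /choice[C HC] k : exists C, 0 <= C /\
    \forall x \near +oo, F k (x * a) <= C * F k x.
  have [C C0 ?] := dominated_tailP (@tail_decr k) (F_gt0 k) (X_dom k) a0.
  by exists C.
exists (\sum_k C k); first by apply: sumr_ge0 => k _; case: (HC k).
have : \forall x \near +oo, forall k, F k (x * a) <= C k * F k x.
  by apply: filter_forall => k; case: (HC k).
apply: filterS => x H k; apply: le_trans (H k) _.
rewrite ler_wpM2r//; first exact: ltW.
by rewrite (bigD1 k)//= lerDl sumr_ge0// => j _; case: (HC j).
Qed.

(** Some [X k] exceeds [x / (n + 1)]. Outside the right-hand side this [X k] is at most [x - l] and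
    the other terms add up to at most [l], so the sum cannot exceed [x]. *)
Lemma total_sum_gt_sub (x l : R) : 0 <= x -> 0 <= l ->
  [set t | total_sum X t > x] `<=`
  \big[setU/set0]_(k < n) [set t | X k t > x - l] `|`
  \big[setU/set0]_(k < n) \big[setU/set0]_(j < n | j != k)
    ([set t | X k t > x * n.+1%:R^-1] `&` [set t | X j t > l * n.+1%:R^-1]).
Proof.
move=> x0 l0 t /= xS.
apply: contrapT => /not_orP[nbig npair].
have le_part (u : R) : 0 <= u -> \sum_(k < n) u * n.+1%:R^-1 <= u.
  move=> u0; rewrite sumr_const card_ord -[leLHS]mulr_natr mulrAC ler_pdivrMr//.
  by rewrite ler_wpM2l// ler_nat.
have [k xk] : exists k, x * n.+1%:R^-1 < X k t.
  apply: contrapT => /forallNP nlarge; move: xS; apply/negP; rewrite -leNgt.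
  apply: le_trans (le_part _ x0); apply: ler_sum => k _.
  by rewrite leNgt; apply/negP.
have kl : X k t <= x - l.
  by rewrite leNgt; apply/negP => ?; apply/nbig/in_bigsetU; exists k.
have jl j : j != k -> X j t <= l * n.+1%:R^-1.
  move=> jk; rewrite leNgt; apply/negP => lj; apply/npair/in_bigsetU.
  exists k => //.
  by apply/in_bigsetU; exists j.
move: xS; apply/negP; rewrite -leNgt /total_sum (bigD1 k)//=.
rewrite -(subrK l x) lerD// (le_trans (ler_sum _ jl))//.
apply: le_trans (le_part _ l0); rewrite [leRHS](bigD1 k)//= lerDr.
by rewrite mulr_ge0.
Qed.

Lemma tail_sum_upper (e : R) : 0 < e -> exists2 l, 0 < l &
  \forall x \near +oo, G x <= B (x - l) + e * B x.
Proof.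
move=> e0; pose N : R := n.+1%:R.
have N0 : 0 < N by rewrite ltr0n.
have [C C0 domC] : exists2 C, 0 <= C &
    \forall x \near +oo, forall k, F k (x * N^-1) <= C * F k x.
  by apply: dominated_tails; rewrite invr_gt0.
have C1 : 0 < C + 1 by lra.
(* For each [k] the pair events cost at most [n * e' * C * F k x], which is below [e * F k x];
   [C + 1] avoids division by zero. *)
have e'0 : 0 < e / (N * (C + 1)) by rewrite divr_gt0// mulr_gt0.
have [M HM] := joint_tail_le e'0; set e' := e / _ in e'0 HM.
(* This makes [l / N] exceed [M], with [l] independent of [x]. *)
exists (N * (`|M| + 1)); first by rewrite mulr_gt0// ltr_wpDl.
set l := N * _.
have l0 : 0 <= l by rewrite mulr_ge0 ?addr_ge0// ltW.
near=> x.
have x0 : 0 <= x by near: x; apply: nbhs_pinfty_ge; rewrite num_real.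
have Mx : M < x * N^-1.
  rewrite ltr_pdivlMr//; near: x; apply: nbhs_pinfty_gt; exact: num_real.
have Ml : M < l * N^-1.
  by rewrite /l mulrAC mulfV ?gt_eqF// mul1r (le_lt_trans (ler_norm _))// ltrDl.
have domx k : F k (x * N^-1) <= C * F k x by move: k; near: x.
have mI k j : measurable ([set t | X k t > x * N^-1] `&` [set t | X j t > l * N^-1]).
  exact: measurableI.
have mII k : measurable (\big[setU/set0]_(j < n | j != k)
    ([set t | X k t > x * N^-1] `&` [set t | X j t > l * N^-1])).
  by apply: bigsetU_measurable.
have mU1 : measurable (\big[setU/set0]_(k < n) [set t | X k t > x - l]).
  by apply: bigsetU_measurable.
have mU2 : measurable (\big[setU/set0]_(k < n) \big[setU/set0]_(j < n | j != k)
    ([set t | X k t > x * N^-1] `&` [set t | X j t > l * N^-1])).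
  by apply: bigsetU_measurable.
apply: (le_trans (le_fine_prob _ _ _ (@total_sum_gt_sub x l x0 l0))) => //.
  exact: measurableU.
rewrite (le_trans (fine_probU_le _ _ _))//; apply: lerD.
  apply: le_trans; first exact: fine_prob_bigU.
  by apply: ler_sum => k _; rewrite /F tail_distr_fun.
apply: le_trans; first exact: fine_prob_bigU.
rewrite /B mulr_sumr; apply: ler_sum => k _.
apply: le_trans; first exact: fine_prob_bigU.
apply: (@le_trans _ _ (\sum_(j < n) e' * (C * F k x))).
  rewrite big_mkcond/=; apply: ler_sum => j _; case: ifP => [jk|_].
    by rewrite (le_trans (HM _ _ _ _ jk Mx Ml))// ler_wpM2l// ltW.
  by apply: mulr_ge0; [exact: ltW|apply: mulr_ge0 => //; exact: ltW].
rewrite sumr_const card_ord -[leLHS]mulr_natr mulrA mulrAC.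
rewrite ler_wpM2r//; first exact: ltW.
rewrite /e' -[leLHS]mulrA mulrAC ler_pdivrMr ?mulr_gt0//.
rewrite ler_wpM2l//; first exact: ltW.
rewrite mulrC ler_pM// ?ler_nat//; lra.
Unshelve. all: by end_near.
Qed.

Hypothesis n_gt0 : (0 < n)%N.

Let B_gt0 x : 0 < B x.
Proof.
by rewrite /B (bigD1 (Ordinal n_gt0))//= ltr_pwDl// sumr_ge0// => k _; exact: ltW.
Qed.

Lemma tail_ratio_lower (e : R) : 0 < e ->
  \forall x \near +oo, 1 - e <= tail_ratio X (total_sum X) x.
Proof.
move=> e0; apply: filterS (tail_sum_lower e0) => x.
by rewrite /tail_ratio -/(G x) -/(B x) ler_pdivlMr.
Qed.

Lemma liminf_tail_ratio :
  limf_einf (fun x => (tail_ratio X (total_sum X) x)%:E) +oo = 1%E.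
Proof.
apply: limf_einf_pinfty_eq; first exact: tail_ratio_lower.
move=> e M e0; have e20 : 0 < e / 2 by rewrite divr_gt0.
have [l l0 [M1 [_ upper]]] := tail_sum_upper e20.
have [C C0 domC] : exists2 C, 0 <= C &
    \forall x \near +oo, forall k, F k (x * 2^-1) <= C * F k x.
  by apply: dominated_tails; rewrite invr_gt0.
have domB : \forall x \near +oo, B (x / 2) <= C * B x.
  apply: filterS domC => x domx; rewrite /B mulr_sumr.
  by apply: ler_sum => k _; exact: domx.
(* Half of [e] pays for the shift by [l], the other half for the pair events; beyond [M1] the upper
   bound on [G] applies. *)
have [x] := dominated_shift (Num.max M M1) B_gt0 domB l0 e20.
rewrite gt_max => /andP[Mx M1x] shift; exists x => //.
rewrite /tail_ratio -/(G x) -/(B x) ler_pdivrMr//.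
have := upper _ M1x; lra.
Qed.

Lemma cvg_tail_ratio : (forall k, long_tail (distr_fun (X k))) ->
  tail_ratio X (total_sum X) x @[x --> +oo] --> (1 : R).
Proof.
move=> X_long; apply/cvgrPdist_le => e e0.
have e20 : 0 < e / 2 by rewrite divr_gt0.
have [l l0 upper] := tail_sum_upper e20.
have long : \forall x \near +oo, forall k, F k (x - l) <= (1 + e / 2) * F k x.
  (* Long tails make the shift bound hold for all large [x], not just for arbitrarily large ones. *)
  apply: filter_forall => k; have /cvgrPdist_le/(_ _ e20) := X_long k (- l).
  apply: filterS => x; rewrite distrC => /(le_trans (ler_norm _)).
  by rewrite lerBlDl ler_pdivrMr; [apply|exact: F_gt0].
near=> x.
have up : G x <= B (x - l) + e / 2 * B x by near: x.
have low : 1 - e <= tail_ratio X (total_sum X) x.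
  by near: x; exact: tail_ratio_lower.
have shift : B (x - l) <= (1 + e / 2) * B x.
  by rewrite /B mulr_sumr; apply: ler_sum => k _; move: k; near: x.
rewrite distrC ler_distl low/=.
rewrite /tail_ratio -/(G x) -/(B x) ler_pdivrMr//; lra.
Unshelve. all: by end_near.
Qed.

End tail_of_sum.

Unset Implicit Arguments.
Set Strict Implicit.

Theorem theorem3p2 (R : realType) (d : measure_display) (T : measurableType d)
    (P : probability T R) (n : nat) (hn : (1 <= n)%N)
    (X : 'I_n -> {RV P >-> R})
    (X_ge0 : forall (k : 'I_n) (t : T), 0 <= X k t)
    (X_heavy : forall k : 'I_n, heavy_tailed (X k))
    (tail_gt0 : forall (k : 'I_n) (x : R), 0 < tail (distr_fun (X k)) x)
    (X_indep : pairwise_tail_independent X)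
    (X_dom : forall k : 'I_n, dominated_tail (distr_fun (X k))) :
  (limf_einf (fun x : R => (tail_ratio X (total_sum X) x)%:E) +oo%R = 1%E /\
   limf_einf (fun x : R => (tail_ratio X (max_partial_sum X) x)%:E) +oo%R
     = 1%E) /\
  ((forall k : 'I_n, long_tail (distr_fun (X k))) ->
   (tail_ratio X (total_sum X) x @[x --> +oo%R] --> (1 : R)) /\
   (tail_ratio X (max_partial_sum X) x @[x --> +oo%R] --> (1 : R))).
Proof.
rewrite (max_partial_sumE X_ge0).
have liminf := liminf_tail_ratio X_ge0 tail_gt0 X_indep X_dom hn.
by split=> [|X_long]; split=> //; exact: cvg_tail_ratio.
Qed.
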